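(* Let $D_{0,0}(0):=1$. Then for $v=(v_1,\dots,v_n)$ a non-zero composition such that its largest part equals $r$ and $I:=\{i\in\{1,\dots,n\}: v_i=r\}$, \[ D_{v,v^+}(a)=D_{v^{(I)},(v^{(I)})^+}\big(a^{(I)}\big)\frac{\left[\begin{smallmatrix}|a|+r-1\\ a,r-1\end{smallmatrix}\right]}{\left[\begin{smallmatrix}|a|-a_I+r-1\\ a^{(I)},r-1\end{smallmatrix}\right]}\sum_{\emptyset\neq J\subseteq I}(-1)^{|I\setminus J|}q^{L_{I,J}(a)}\frac{1-q^{a_J}}{1-q^{|a|-a_J+r}}, \] where $|S|$ is the cardinality of $S$, $a_S:=\sum_{j\in S}a_j$, and $L_{I,J}(a)=\sum_{1\le i\le j\le n,\ i\in I,\ j\notin J}a_j$.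
   Context: For $a=(a_1,\dots,a_n)$ positive integers, $x^{(a)}$ is the alphabet $(x_1,x_1q,\dots,x_1q^{a_1-1},\dots,x_n,\dots,x_nq^{a_n-1})$, $h_\lambda=h_{\lambda_1}h_{\lambda_2}\cdots$ products of complete symmetric functions, $(z;q)_k=(1-z)\cdots(1-zq^{k-1})$, and $D_{v,\lambda}(a):=\mathrm{CT}_x\, x^{-v}h_\lambda(x^{(a)})\prod_{1\le i<j\le n}(x_i/x_j;q)_{a_i}(qx_j/x_i;q)_{a_j}$ (constant term in $x$). $v^+$ denotes $v$ sorted in weakly decreasing order. For $I\subseteq\{1,\dots,n\}$, $s^{(I)}$ is $s$ with the entries indexed by $I$ removed. $|a|=a_1+\cdots+a_n$. For a composition $c$ with $|c|=n$, $\left[\begin{smallmatrix}n\\ c\end{smallmatrix}\right]=(q;q)_n/\prod_i(q;q)_{c_i}$ is the $q$-multinomial coefficient; here $(a,r-1)$ denotes the composition $(a_1,\dots,a_n,r-1)$. *)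

(* Defs.v *)
From HB Require Import structures.
From mathcomp Require Import all_boot all_order all_algebra.
From mathcomp Require Import mpoly.
From Stdlib Require Import ClassicalEpsilon.

Set Implicit Arguments.
Unset Strict Implicit.
Unset Printing Implicit Defensive.

Import GRing.Theory.
Local Open Scope ring_scope.

Local Notation tofrac := (@FracField.tofrac _).
Local Notation "x %:F" := (tofrac x).

Definition qpoch (R : pzRingType) (z q : R) (k : nat) : R :=
  \prod_(i < k) (1 - z * q ^+ i).

(* It is the caller's responsibility that sumn c = m. *)
Definition qmultinom (F : fieldType) (q : F) (m : nat) (c : seq nat) : F :=
  qpoch q q m / \prod_(k <- c) qpoch q q k.

(* h_k on a finite alphabet s: the sum of all products of k letters of s, a
   product being given by the weakly increasing tuple of its positions in s. *)
Definition hsym (R : comPzRingType) (s : seq R) (k : nat) : R :=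
  \sum_(t : k.-tuple 'I_(size s) | sorted leq [seq val i | i <- t])
    \prod_(i <- t) s`_i.

Definition hsymp (R : comPzRingType) (s : seq R) (lam : seq nat) : R :=
  \prod_(k <- lam) hsym s k.

(* Laurent polynomials in n variables over F are regarded as the elements f of
   the field of rational functions such that x^m f is a polynomial for some
   exponent m; the constant term of f is then the coefficient of x^m in x^m f. *)
Definition ratf (F : fieldType) (n : nat) := {fraction {mpoly F[n]}}.

Definition rX (F : fieldType) (n : nat) (i : 'I_n) : ratf F n :=
  ('X_i : {mpoly F[n]})%:F.

Definition rC (F : fieldType) (n : nat) (c : F) : ratf F n :=
  (c%:MP : {mpoly F[n]})%:F.

Definition is_laurent (F : fieldType) (n : nat) (f : ratf F n) : Prop :=
  exists (m : 'X_{1..n}) (p : {mpoly F[n]}), ('X_[m])%:F * f = p%:F.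

Definition is_CT (F : fieldType) (n : nat) (f : ratf F n) (c : F) : Prop :=
  exists (m : 'X_{1..n}) (p : {mpoly F[n]}),
    ('X_[m])%:F * f = p%:F /\ c = p@_m.

Definition CT (F : fieldType) (n : nat) (f : ratf F n) : F :=
  epsilon (inhabits 0) (is_CT f).

Lemma CTE (F : fieldType) (n : nat) (f : ratf F n) (m : 'X_{1..n})
  (p : {mpoly F[n]}) : ('X_[m])%:F * f = p%:F -> CT f = p@_m.
Proof.
move=> fE; have exc : exists c, is_CT f c by exists p@_m, m, p.
rewrite /CT; have [m' [p' [fE' ->]]] := epsilon_spec (inhabits 0) _ exc.
have pp' : 'X_[m'] * p = 'X_[m] * p'.
  by apply/eqP; rewrite -tofrac_eq !tofracM -fE -fE' mulrCA.
by rewrite -(mcoeffMX p' m m') -(mcoeffMX p m' m) mulrC -pp' mulrC addmC.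
Qed.

(* The alphabet (x_1, x_1 q, ..., x_1 q^(a_1-1), ..., x_n, ..., x_n q^(a_n-1)). *)
Definition alphabet (F : fieldType) (q : F) (n : nat) (a : n.-tuple nat) :
    seq (ratf F n) :=
  [seq rX F i * rC n q ^+ j | i <- enum 'I_n, j <- iota 0 (tnth a i)].

Definition kernelD (F : fieldType) (q : F) (n : nat) (v : n.-tuple nat)
    (lam : seq nat) (a : n.-tuple nat) : ratf F n :=
  (\prod_(i < n) rX F i ^- tnth v i) * hsymp (alphabet q a) lam *
  \prod_(i < n) \prod_(j < n | (i < j)%N)
    (qpoch (rX F i / rX F j) (rC n q) (tnth a i) *
     qpoch (rC n q * rX F j / rX F i) (rC n q) (tnth a j)).

Definition D (F : fieldType) (q : F) (n : nat) (v : n.-tuple nat)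
    (lam : seq nat) (a : n.-tuple nat) : F :=
  CT (kernelD q v lam a).

Section Laurent.
Variables (F : fieldType) (n : nat).
Implicit Types f g : ratf F n.

Lemma is_laurent_poly (p : {mpoly F[n]}) : is_laurent p%:F.
Proof. by exists 0%MM, p; rewrite mpolyX0 tofrac1 mul1r. Qed.

Lemma is_laurent1 : is_laurent (1 : ratf F n).
Proof. by rewrite -tofrac1; apply: is_laurent_poly. Qed.

Lemma is_laurentM f g : is_laurent f -> is_laurent g -> is_laurent (f * g).
Proof.
move=> [m [p fE]] [m' [p' gE]]; exists (m + m')%MM, (p * p').
by rewrite mpolyXD !tofracM mulrACA fE gE.
Qed.

Lemma is_laurentD f g : is_laurent f -> is_laurent g -> is_laurent (f + g).
Proof.
move=> [m [p fE]] [m' [p' gE]]; exists (m + m')%MM, ('X_[m'] * p + 'X_[m] * p').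
by rewrite mpolyXD tofracD !tofracM mulrDr -fE -gE !mulrA ['X_[m']%:F * _]mulrC.
Qed.

Lemma is_laurentN f : is_laurent f -> is_laurent (- f).
Proof. by move=> [m [p fE]]; exists m, (- p); rewrite mulrN fE tofracN. Qed.

Lemma rX_neq0 (i : 'I_n) : rX F i != 0.
Proof. by rewrite /rX tofrac_eq0 -msupp_eq0 msuppX. Qed.

Lemma is_laurentVX (i : 'I_n) : is_laurent (rX F i)^-1.
Proof. by exists U_(i)%MM, 1; rewrite tofrac1 divff // rX_neq0. Qed.

Lemma is_laurentXn f k : is_laurent f -> is_laurent (f ^+ k).
Proof.
move=> fL; elim: k => [|k IHk]; first by rewrite expr0; apply: is_laurent1.
by rewrite exprS; apply: is_laurentM.
Qed.

Lemma is_laurent_prod (I : Type) (r : seq I) (P : pred I) (f : I -> ratf F n) :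
  (forall i, P i -> is_laurent (f i)) -> is_laurent (\prod_(i <- r | P i) f i).
Proof.
move=> fL; apply: (big_ind (@is_laurent F n)) => //; first exact: is_laurent1.
exact: is_laurentM.
Qed.

Lemma is_laurent_qpoch f g k :
  is_laurent f -> is_laurent g -> is_laurent (qpoch f g k).
Proof.
move=> fL gL; apply: is_laurent_prod => i _; apply: is_laurentD.
  exact: is_laurent1.
by apply: is_laurentN; apply: is_laurentM => //; apply: is_laurentXn.
Qed.

Lemma is_laurent_hsym (s : seq (ratf F n)) k :
  (forall f, f \in s -> is_laurent f) -> is_laurent (hsym s k).
Proof.
move=> sL; apply: (big_ind (@is_laurent F n)).
- by rewrite -tofrac0; apply: is_laurent_poly.
- exact: is_laurentD.
by move=> t _; apply: is_laurent_prod => i _; apply/sL/mem_nth.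
Qed.

(* Hence D is never an unspecified value of epsilon. *)
Lemma is_laurent_kernelD (q : F) (v : n.-tuple nat) (lam : seq nat)
  (a : n.-tuple nat) : is_laurent (kernelD q v lam a).
Proof.
have XL (i : 'I_n) : is_laurent (rX F i) by exact: (is_laurent_poly 'X_i).
have qL : is_laurent (rC n q) by exact: (is_laurent_poly q%:MP).
apply: is_laurentM; first apply: is_laurentM.
- apply: is_laurent_prod => i _; rewrite -exprVn.
  by apply: is_laurentXn; apply: is_laurentVX.
- apply: is_laurent_prod => k _; apply: is_laurent_hsym => f.
  case/allpairsPdep=> i [j [_ _ ->]].
  by apply: is_laurentM => //; apply: is_laurentXn.
apply: is_laurent_prod => i _; apply: is_laurent_prod => j _.
apply: is_laurentM; apply: is_laurent_qpoch => //.
  by apply: is_laurentM => //; apply: is_laurentVX.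
by apply: is_laurentM; [apply: is_laurentM | apply: is_laurentVX].
Qed.

End Laurent.

(* The convention D_{0,0}(0) := 1 for the empty compositions. *)
Lemma D_empty (F : fieldType) (q : F) (v a : 0.-tuple nat) : D q v [::] a = 1.
Proof.
have -> : D q v [::] a = (1 : {mpoly F[0]})@_0%MM.
  by apply: CTE; rewrite /kernelD /hsymp !big_ord0 big_nil mpolyX0 !mulr1.
by rewrite mcoeff1 eqxx.
Qed.

Definition sort_decr (s : seq nat) : seq nat := sort geq s.

(* s^(I); since 'I_n is enumerated in increasing order, the remaining entries
   keep their relative order. *)
Definition rem_entries (n : nat) (I : {set 'I_n}) (s : n.-tuple nat) :
    #|~: I|.-tuple nat :=
  [tuple of [seq tnth s i | i in ~: I]].

Definition asum (n : nat) (a : n.-tuple nat) (S : {set 'I_n}) : nat :=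
  \sum_(j in S) tnth a j.

Definition Lexp (n : nat) (I J : {set 'I_n}) (a : n.-tuple nat) : nat :=
  \sum_(i in I) \sum_(j < n | (i <= j)%N && (j \notin J)) tnth a j.

(* Main.v *)
(* Expanding one factor h_r into partial fractions over the letters, the letter
   x_i q^j clears all denominators of the kernel in the pairs containing x_i and
   turns the kernel into a polynomial in x_i whose remaining variables only carry
   the kernel without x_i.  Hence the constant term in x_i is obtained by setting
   x_i = 0, and it vanishes unless v_i = r.  Summing over j (a q-binomial sum)
   gives a recursion removing one index of I at a time; the alternating sum over
   J satisfies the same recursion, by a partial fraction identity, a telescoping
   sum, and a sign-reversing toggle of the least element of I \ {i}. *)
Require Import Defs.
From HB Require Import structures.
From mathcomp Require Import all_boot all_order all_algebra.
From mathcomp Require Import mpoly ring.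
Import GRing.Theory.
Set Implicit Arguments.
Unset Strict Implicit.
Unset Printing Implicit Defensive.
Local Open Scope ring_scope.

(** Two obstacles shape the proof. Setting x_i = 0 is not a map on the field of rational functions.
    So specialization is a relation, [spec], witnessed by a monomial multiple that is a polynomial;
    it is compatible with the ring operations, makes its left side Laurent and, for injective
    renamings, preserves [CT]. The other obstacle is that each removal of an index changes the
    number of variables. The recursion therefore stays in one field, on subsets [S] of the indices,
    with letters indexed by pairs (i, j) so that the alphabets of [S] and [S :\ i] can be compared;
    a single renaming at the end, again a [spec], returns to the shorter tuples. As q is nonzero and
    not a root of unity, the letters are pairwise distinct, as partial fractions require, and the
    factors 1 - q^k with k > 0 are invertible. *)

Local Notation "x %:F" := (@FracField.tofrac _ x).

(** * Complete symmetric functions and partial fractions *)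

Section CompleteSymmetric.
Variable R : comPzRingType.
Implicit Types (s : seq R) (x : R).

Lemma big_tupleS (T : finType) k (P : pred (seq T)) (G : seq T -> R) :
  \sum_(t : k.+1.-tuple T | P t) G t =
    \sum_(x : T) \sum_(t : k.-tuple T | P (x :: t)) G (x :: t).
Proof.
rewrite pair_big_dep /=.
rewrite (reindex (fun p : T * k.-tuple T => cons_tuple p.1 p.2)) //=.
exists (fun t : k.+1.-tuple T => (thead t, [tuple of behead t])).
  by case=> x t _; congr pair; apply/val_inj.
by move=> t _; rewrite [RHS]tuple_eta; apply/val_inj.
Qed.

Lemma hsym0 s : hsym s 0 = 1.
Proof.
rewrite /hsym (big_pred1 [tuple]) ?big_nil // => t.
by rewrite [t]tuple0; apply/esym/eqP.
Qed.

Lemma hsym_nil k : hsym ([::] : seq R) k.+1 = 0.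
Proof. by rewrite /hsym big1 // => t; case: (thead t). Qed.

(** A weakly increasing tuple bounded below by [j.+1] never visits position 0, so [x] does not occur
    and all positions shift down by one. *)
Lemma sum_path_lift x s k (j : nat) :
  \sum_(t : k.-tuple 'I_(size s).+1 | path leq j.+1 (map val t))
      \prod_(i <- t) (x :: s)`_i =
  \sum_(t : k.-tuple 'I_(size s) | path leq j (map val t))
      \prod_(i <- t) s`_i.
Proof.
elim: k j => [|k IHk] j.
  by rewrite !(big_pred1 [tuple]) ?big_nil // => t; rewrite [t]tuple0; apply/esym/eqP.
rewrite (big_tupleS _ (fun t : seq 'I_(size s).+1 => path leq j.+1 (map val t))
  (fun t => \prod_(i <- t) (x :: s)`_i)) big_ord_recl /= big_pred0_eq add0r.
rewrite (big_tupleS _ (fun t : seq 'I_(size s) => path leq j (map val t))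
  (fun t => \prod_(i <- t) s`_i)).
apply: eq_bigr => i _; rewrite /= /bump /= add1n ltnS.
case: (j <= i)%N => /=; last by rewrite !big_pred0_eq.
under eq_bigr do rewrite big_cons /=.
by rewrite -big_distrr /= IHk big_distrr; apply: eq_bigr => t _; rewrite big_cons.
Qed.

(** Splits on the first position: if it is 0, a letter [x] factors out and the tail is any sorted
    tuple; otherwise [x] does not occur. *)
Lemma hsym_cons x s k : hsym (x :: s) k.+1 = hsym s k.+1 + x * hsym (x :: s) k.
Proof.
rewrite /hsym (big_tupleS _ (fun t : seq 'I_(size s).+1 => sorted leq (map val t))
  (fun t => \prod_(i <- t) (x :: s)`_i)) /= big_ord_recl addrC; congr (_ + _).
  rewrite (big_tupleS _ (fun t : seq 'I_(size s) => sorted leq (map val t))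
    (fun t => \prod_(i <- t) s`_i)).
  apply: eq_bigr => i _ /=.
  under eq_bigr do rewrite big_cons /=.
  rewrite -big_distrr /= sum_path_lift big_distrr.
  by apply: eq_bigr => t _; rewrite big_cons.
under eq_bigr do rewrite big_cons /=.
rewrite -big_distrr /=; congr (_ * _); apply: eq_bigl => t.
by rewrite path_min_sorted //; apply/allP.
Qed.

Lemma hsym_scale (c : R) s k :
  hsym [seq c * x | x <- s] k = c ^+ k * hsym s k.
Proof.
elim: s k => [|x s IHs] [|k]; rewrite ?hsym0 ?hsym_nil ?mulr0 ?mul1r //=.
elim: k => [|k IHk]; rewrite [LHS]hsym_cons [X in _ = _ * X]hsym_cons IHs.
  by rewrite !hsym0; ring.
by rewrite IHk !exprS; ring.
Qed.

(** Used once x_i is set to 0: its letters become zero and drop out of the alphabet. *)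
Lemma hsym_map_filter (T : Type) (P : pred T) (f : T -> R) (t : seq T) k :
  (forall x : T, ~~ P x -> f x = 0) ->
  hsym (map f t) k = hsym (map f (filter P t)) k.
Proof.
move=> f0; elim: t k => [|x t IHt] [|k]; rewrite ?hsym0 //=.
case: ifPn => [_|/f0 fx0] /=; last by rewrite hsym_cons IHt fx0 mul0r addr0.
by elim: k => [|k IHk]; rewrite [LHS]hsym_cons [RHS]hsym_cons IHt ?hsym0 ?IHk.
Qed.

End CompleteSymmetric.

Section PartialFractions.
Variable K : fieldType.
Implicit Types (s : seq K) (x y : K).

(* The exponent of y is shifted by one so that y ^ -1 is covered. *)
Let pfsum s k : K :=
  \sum_(y <- s) y ^+ k / y / \prod_(z <- s | z != y) (1 - z / y).

Let pfsum_perm s s' k : perm_eq s s' -> pfsum s k = pfsum s' k.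
Proof.
move=> ss'; rewrite /pfsum (perm_big s') //=; apply: eq_bigr => y _.
by rewrite (perm_big s').
Qed.

(** The same recursion as [hsym_cons]; for y in [s] it comes from 1 + (x / y) / (1 - x / y) = 1 / (1
    - x / y). *)
Let pfsum_cons x s k : uniq (x :: s) -> 0 \notin x :: s ->
  pfsum (x :: s) k.+1 = pfsum s k.+1 + x * pfsum (x :: s) k.
Proof.
move=> /= /andP[xs us]; rewrite inE negb_or eq_sym => /andP[x0 s0].
rewrite /pfsum !big_cons eqxx /= mulrDr addrCA; congr (_ + _).
  by rewrite exprS !mulrA.
rewrite mulr_sumr -big_split /=; apply: eq_big_seq => y ys.
have xy : x != y by apply: contraNneq xs => ->.
have y0 : y != 0 by apply: contraNneq s0 => <-.
rewrite big_cons xy.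
have P0 : \prod_(j <- s | j != y) (1 - j / y) != 0.
  rewrite prodf_seq_neq0; apply/allP => z zs; apply/implyP => zy.
  by apply: contra zy; rewrite subr_eq0 => /eqP e; rewrite -[z](divfK y0) -e mul1r.
have x1 : 1 - x / y != 0.
  by apply: contra xy; rewrite subr_eq0 => /eqP e; rewrite -[x](divfK y0) -e mul1r.
have yx : y - x != 0 by rewrite subr_eq0 eq_sym.
by rewrite exprS; field; rewrite P0 y0.
Qed.

(** Removing either of two letters x, y by [pfsum_cons] gives 1 + x * g = 1 + y * g, where g is
    [pfsum] at 0; hence g = 0. *)
Let pfsum1 s : uniq s -> 0 \notin s -> s != [::] -> pfsum s 1 = 1.
Proof.
elim: {s}(size s) {-2}s (leqnn (size s)) => [|m IHm] [|x [|y s]] //= sm.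
  move=> _; rewrite inE eq_sym => x0 _.
  by rewrite /pfsum big_seq1 big_cons eqxx big_nil /= expr1 !divff ?oner_eq0.
move=> us s0 _.
have us' : uniq (x :: s).
  by move: us; rewrite /= inE negb_or => /andP[/andP[_ ->] /andP[_ ->]].
have us'' : uniq (y :: s) by case/andP: us.
have s0'' : 0 \notin y :: s by apply: contra s0 => h; rewrite inE h orbT.
have s0' : 0 \notin x :: s.
  by apply: contra s0; rewrite !inE => /orP[->//|->]; rewrite !orbT.
have xy : x != y by move: us; rewrite /= inE negb_or -andbA => /andP[].
have p : perm_eq [:: x, y & s] [:: y, x & s].
  by rewrite (perm_catCA [:: x] [:: y] s).
have e1 := pfsum_cons 0 us s0.
have e2 : pfsum [:: x, y & s] 1 = pfsum (x :: s) 1 + y * pfsum [:: x, y & s] 0.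
  rewrite !(pfsum_perm _ p) pfsum_cons // ?(perm_uniq (perm_sym _ _)) //.
    by rewrite -(perm_uniq p).
  by rewrite -(perm_mem p).
rewrite (IHm (y :: s)) // in e1; rewrite (IHm (x :: s)) // in e2.
have /eqP : (x - y) * pfsum [:: x, y & s] 0 = 0.
  by rewrite mulrBl; apply/eqP; rewrite subr_eq0 -(inj_eq (addrI 1)) -e1 -e2.
rewrite mulf_eq0 subr_eq0 (negPf xy) /= => /eqP g0.
by rewrite e1 g0 mulr0 addr0.
Qed.

Lemma hsym_partial_fractions s k : uniq s -> 0 \notin s -> (0 < k)%N ->
  hsym s k = \sum_(y <- s) y ^+ k / \prod_(z <- s | z != y) (1 - z / y).
Proof.
have pfE s' k' : 0 \notin s' -> pfsum s' k'.+1 =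
    \sum_(y <- s') y ^+ k' / \prod_(z <- s' | z != y) (1 - z / y).
  move=> s0; apply: eq_big_seq => y ys.
  have y0 : y != 0 by apply: contraNneq s0 => <-.
  by rewrite exprSr mulfK.
move=> us s0 k0; rewrite -pfE //.
(* The induction on [k] has to start at 0, where the identity fails only for the empty alphabet. *)
have {k0} : (s != [::]) || (0 < k)%N by rewrite k0 orbT.
elim: s us s0 k => [|x s IHs] us s0 k.
  by case: k => // k _; rewrite hsym_nil /pfsum big_nil.
move=> _; elim: k => [|k IHk]; first by rewrite hsym0 pfsum1.
rewrite hsym_cons pfsum_cons // IHk IHs ?orbT //; first by case/andP: us.
by apply: contra s0 => h; rewrite inE h orbT.
Qed.

End PartialFractions.

(** * q-shifted factorials and the cancellation in one pair of variables *)

Section QSeries.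
Variable K : fieldType.
Implicit Types (q z : K).

Lemma qpochS (R : pzRingType) (z q : R) k :
  qpoch z q k.+1 = qpoch z q k * (1 - z * q ^+ k).
Proof. exact: big_ord_recr. Qed.

Lemma qpoch_shift z q k :
  qpoch z q k * (1 - z * q ^+ k) = (1 - z) * qpoch (z * q) q k.
Proof.
rewrite -qpochS /qpoch big_ord_recl expr0 mulr1; congr (_ * _).
by apply: eq_bigr => i _; rewrite exprS mulrA.
Qed.

(** The principal specialization of h_M is a q-binomial coefficient, here cleared of denominators so
    that it holds for every q. Splitting off the letter 1 turns [hsym_cons] into a q-Pascal rule. *)
Lemma hsym_geom q a M :
  hsym [seq q ^+ j | j <- iota 0 a.+1] M * (qpoch q q M * qpoch q q a) =
    qpoch q q (M + a).
Proof.
have geomS b : [seq q ^+ j | j <- iota 0 b.+1] =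
    1 :: [seq q * x | x <- [seq q ^+ j | j <- iota 0 b]].
  rewrite /= expr0 (iotaDl 1 0) -!map_comp; congr cons; apply: eq_map => j /=.
  by rewrite add1n exprS.
have Q0 : qpoch q q 0 = 1 by rewrite /qpoch big_ord0.
elim: a M => [|a IHa] M.
  rewrite Q0 mulr1 addn0 -[RHS]mul1r; congr (_ * _).
  by elim: M => [|M IHM]; rewrite ?hsym0 // geomS hsym_cons hsym_nil add0r mul1r -geomS.
elim: M => [|M IHM]; first by rewrite hsym0 Q0 !mul1r.
rewrite geomS hsym_cons -geomS mul1r hsym_scale mulrDl.
have -> : q ^+ M.+1 * hsym [seq q ^+ j | j <- iota 0 a.+1] M.+1 *
    (qpoch q q M.+1 * qpoch q q a.+1) =
    q ^+ M.+1 * (1 - q ^+ a.+1) * qpoch q q (M.+1 + a).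
  by rewrite -IHa (qpochS _ _ a) !exprS; ring.
have -> : hsym [seq q ^+ j | j <- iota 0 a.+2] M *
    (qpoch q q M.+1 * qpoch q q a.+1) =
    (1 - q ^+ M.+1) * qpoch q q (M + a.+1).
  rewrite -IHM (qpochS _ _ M) exprS.
  by move: (hsym _ M) (qpoch q q M) (qpoch q q a.+1) => H A B; ring.
rewrite !addnS !addSn (qpochS _ _ (M + a).+1) !exprS exprD.
by move: (qpoch q q _) => A; ring.
Qed.

(* The factor (q ^ (1 - j) / t; q)_b is the denominator that a letter of the
   partial fraction expansion brings to a pair of variables; what remains is a
   polynomial in t. *)
Lemma qpoch_cancel q t (a b j : nat) : q != 0 -> t != 0 -> (j <= a)%N ->
  qpoch (q / t) q b * qpoch t q a =
  qpoch (q / (q ^+ j * t)) q b *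
    (\prod_(0 <= l < j) (q ^+ b - q ^+ l * t) *
     \prod_(j <= l < a) (1 - q ^+ l * t)).
Proof.
move=> q0 t0; elim: j => [|j IHj] ja.
  rewrite big_nil mul1r expr0 mul1r; congr (_ * _).
  by rewrite /qpoch big_mkord; apply: eq_bigr => l _; rewrite mulrC.
rewrite IHj 1?ltnW // big_nat_recr //= (big_ltn ja) !mulrA; congr (_ * _).
rewrite -!mulrA [RHS]mulrCA [LHS]mulrCA; congr (_ * _).
have qj0 : q ^+ j != 0 by rewrite expf_neq0.
have := qpoch_shift (q / (q ^+ j.+1 * t)) q b.
have -> : q / (q ^+ j.+1 * t) * q = q / (q ^+ j * t).
  by rewrite exprS; field; rewrite ?t0 ?q0 ?qj0.
move: (qpoch _ _ _) (qpoch _ _ _) => A B e.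
have -> : 1 - q ^+ j * t = - (q ^+ j * t) * (1 - q / (q ^+ j.+1 * t)).
  by rewrite exprS; field; rewrite ?t0 ?q0 ?qj0.
have -> : q ^+ b - q ^+ j * t =
    - (q ^+ j * t) * (1 - q / (q ^+ j.+1 * t) * q ^+ b).
  by rewrite exprS; field; rewrite ?t0 ?q0 ?qj0.
by rewrite [RHS]mulrCA e mulrCA [A * _]mulrC.
Qed.

(** With t = x / y the cut must be at [j.+1] for q / (q^(j+1) t) to be y / (x q^j). In
    [qpoch_pair_gt], t = q x / y and the cut is at [j]; this shift is the source of the powers of q
    that depend on the order of the indices. *)
Lemma qpoch_pair_lt q x y (a b j : nat) : q != 0 -> x != 0 -> y != 0 ->
  (j < a)%N ->
  qpoch (x / y) q a * qpoch (q * y / x) q b =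
  qpoch (y / (x * q ^+ j)) q b *
    (\prod_(0 <= l < j.+1) (q ^+ b - q ^+ l * (x / y)) *
     \prod_(j.+1 <= l < a) (1 - q ^+ l * (x / y))).
Proof.
move=> q0 x0 y0 ja; have qj := expf_neq0 j q0.
have -> : q * y / x = q / (x / y) by field; rewrite x0 y0.
rewrite mulrC (@qpoch_cancel q (x / y) _ _ j.+1) ?mulf_neq0 ?invr_eq0 //.
by congr (qpoch _ _ _ * _); rewrite exprS; field; rewrite ?x0 ?y0 ?q0 ?qj.
Qed.

Lemma qpoch_pair_gt q x y (a b j : nat) : q != 0 -> x != 0 -> y != 0 ->
  (j < a)%N ->
  qpoch (y / x) q b * qpoch (q * x / y) q a =
  qpoch (y / (x * q ^+ j)) q b *
    (\prod_(0 <= l < j) (q ^+ b - q ^+ l * (q * x / y)) *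
     \prod_(j <= l < a) (1 - q ^+ l * (q * x / y))).
Proof.
move=> q0 x0 y0 ja; have qj := expf_neq0 j q0.
have -> : y / x = q / (q * x / y) by field; rewrite ?x0 ?y0 ?q0.
rewrite (@qpoch_cancel q (q * x / y) _ _ j) ?(ltnW ja) ?mulf_neq0 ?invr_eq0 //.
by congr (qpoch _ _ _ * _); field; rewrite ?x0 ?y0 ?q0 ?qj.
Qed.

End QSeries.

(** * Specialization of variables *)

Section Specialization.
Variables (F : fieldType) (m n : nat) (u : 'I_m -> option 'I_n).
Hypothesis u_inj : forall i j k, u i = Some k -> u j = Some k -> i = j.

Definition spec_poly (p : {mpoly F[m]}) : {mpoly F[n]} :=
  p \mPo [tuple oapp (fun j => 'X_j) 0 (u i) | i < m].

Definition spec_mon (d : 'X_{1..m}) : 'X_{1..n} :=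
  (\sum_(i < m) (oapp (fun j => U_(j)) 0 (u i)) *+ d i)%MM.

Definition kept (d : 'X_{1..m}) := [forall i, (u i == None) ==> (d i == 0%N)].

(* g arises from f by renaming x_i to x_(u i) where u i is defined and setting
   the other variables, which must not occur in denominators, to 0. *)
Definition spec (f : ratf F m) (g : ratf F n) : Prop :=
  exists (d : 'X_{1..m}) (p : {mpoly F[m]}),
    [/\ kept d, 'X_[d]%:F * f = p%:F & 'X_[spec_mon d]%:F * g = (spec_poly p)%:F].

Lemma spec_mon0 : spec_mon 0 = 0%MM.
Proof. by rewrite /spec_mon big1 // => i _; rewrite mnm0E mulm0n. Qed.

Lemma spec_monD d e : spec_mon (d + e) = (spec_mon d + spec_mon e)%MM.
Proof.
apply/mnmP => j; rewrite mnmDE /spec_mon !mnm_sumE -big_split /=.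
by apply: eq_bigr => i _; rewrite !mulmnE mnmDE mulnDr.
Qed.

Lemma kept0 : kept 0.
Proof. by apply/forallP => i; rewrite mnm0E eqxx implybT. Qed.

Lemma keptD d e : kept d -> kept e -> kept (d + e).
Proof.
move=> /forallP dk /forallP ek; apply/forallP => i.
by have := dk i; have := ek i; rewrite mnmDE addn_eq0; case: (u i == None) => //= -> ->.
Qed.

Lemma spec_monE d i j : u i = Some j -> spec_mon d j = d i.
Proof.
move=> ui; rewrite /spec_mon mnm_sumE (bigD1 i) //= big1 ?addn0.
  by rewrite ui /= mulmnE mnm1E eqxx mul1n.
move=> k ki; rewrite mulmnE; case uk: (u k) => [l|] /=; last by rewrite mnm0E.
rewrite mnm1E; case: eqP => [lj|//]; rewrite lj in uk.
by rewrite (u_inj uk ui) eqxx in ki.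
Qed.

Lemma spec_mon_inj d e : kept d -> kept e -> (spec_mon d == spec_mon e) = (d == e).
Proof.
move=> /forallP dk /forallP ek; apply/eqP/eqP => [de|->//]; apply/mnmP => i.
case ui: (u i) => [j|]; first by rewrite -!(spec_monE _ ui) de.
by have := dk i; have := ek i; rewrite ui /= => /eqP -> /eqP ->.
Qed.

Lemma spec_polyX d : spec_poly 'X_[d] = if kept d then 'X_[spec_mon d] else 0.
Proof.
rewrite /spec_poly comp_mpolyX /kept; case: forallP => [dk|].
  rewrite -mprodXE; apply: eq_bigr => i _; rewrite -mpolyXn tnth_mktuple.
  by have := dk i; case: (u i) => //= /eqP ->; rewrite !expr0.
move/forallP; rewrite negb_forall => /existsP[i]; rewrite negb_imply => /andP[/eqP ui di].
by rewrite (bigD1 i) //= tnth_mktuple ui /= expr0n (negPf di) mul0r.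
Qed.

(** Monomials with a killed variable vanish and the kept ones are renamed injectively, so no other
    monomial lands on [spec_mon d]. *)
Lemma mcoeff_spec p d : kept d -> (spec_poly p)@_(spec_mon d) = p@_d.
Proof.
move=> dk; rewrite {1}/spec_poly comp_mpolyEX [in RHS](mpolyE p) !raddf_sum /=.
apply: eq_bigr => e _; rewrite !mcoeffZ -/(spec_poly _) spec_polyX mcoeffX.
congr (_ * _); case: ifPn => ek; first by rewrite mcoeffX spec_mon_inj.
by rewrite mcoeff0; case: eqP => // ed; rewrite -ed (negPf ek) in dk.
Qed.

Lemma spec_CT f g : spec f g -> CT f = CT g.
Proof. by case=> d [p [dk fE gE]]; rewrite (CTE fE) (CTE gE) mcoeff_spec. Qed.

Lemma spec_laurent f g : spec f g -> is_laurent f.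
Proof. by case=> d [p [_ fE _]]; exists d, p. Qed.

Lemma spec_const c : spec (rC m c) (rC n c).
Proof.
exists 0%MM, c%:MP; rewrite kept0 spec_mon0 !mpolyX0 !tofrac1 !mul1r.
by rewrite /spec_poly comp_mpolyC.
Qed.

Lemma rC1 k : rC k (1 : F) = 1. Proof. by rewrite /rC mpolyC1 tofrac1. Qed.

Lemma spec1 : spec 1 1.
Proof. by rewrite -!rC1; apply: spec_const. Qed.

Lemma spec0 : spec 0 0.
Proof. by have := spec_const 0; rewrite /rC !mpolyC0 !tofrac0. Qed.

Lemma specM f g f' g' : spec f g -> spec f' g' -> spec (f * f') (g * g').
Proof.
case=> d [p [dk fE gE]] [e [p' [ek fE' gE']]]; exists (d + e)%MM, (p * p').
split; first exact: keptD.
  by rewrite mpolyXD !tofracM mulrACA fE fE'.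
by rewrite spec_monD mpolyXD tofracM mulrACA gE gE' /spec_poly rmorphM tofracM.
Qed.

Lemma specD f g f' g' : spec f g -> spec f' g' -> spec (f + f') (g + g').
Proof.
case=> d [p [dk fE gE]] [e [p' [ek fE' gE']]].
exists (d + e)%MM, ('X_[e] * p + 'X_[d] * p'); split; first exact: keptD.
  by rewrite mpolyXD tofracD !tofracM mulrDr -fE -fE' !mulrA ['X_[e]%:F * _]mulrC.
rewrite spec_monD mpolyXD /spec_poly rmorphD !rmorphM /= -!/(spec_poly _).
rewrite !spec_polyX dk ek tofracD !tofracM mulrDr -gE -gE' !mulrA.
by rewrite ['X_[spec_mon e]%:F * _]mulrC.
Qed.

Lemma specN f g : spec f g -> spec (- f) (- g).
Proof.
case=> d [p [dk fE gE]]; exists d, (- p).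
by rewrite !mulrN fE gE /spec_poly !raddfN.
Qed.

Lemma spec_var i j : u i = Some j -> spec (rX F i) (rX F j).
Proof.
move=> ui; exists 0%MM, 'X_i.
rewrite kept0 spec_mon0 !mpolyX0 !tofrac1 !mul1r; split=> //.
by rewrite /spec_poly comp_mpolyXU -tnth_nth tnth_mktuple ui.
Qed.

Lemma spec_var0 i : u i = None -> spec (rX F i) 0.
Proof.
move=> ui; exists 0%MM, 'X_i.
rewrite kept0 spec_mon0 !mpolyX0 !tofrac1 !mul1r; split=> //.
by rewrite /spec_poly comp_mpolyXU -tnth_nth tnth_mktuple ui tofrac0.
Qed.

Lemma spec_varV i j : u i = Some j -> spec (rX F i)^-1 (rX F j)^-1.
Proof.
move=> ui; exists U_(i)%MM, 1.
have k : kept U_(i).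
  apply/forallP => k; apply/implyP => /eqP uk; rewrite mnm1E.
  by case: (eqVneq i k) => // ik; rewrite ik uk in ui.
have -> : spec_mon U_(i) = U_(j)%MM.
  rewrite /spec_mon (bigD1 i) //= mnm1E eqxx mulm1n ui /= big1 ?addm0 // => l li.
  by rewrite mnm1E eq_sym (negPf li) mulm0n.
split=> //; first by rewrite tofrac1 divff // rX_neq0.
by rewrite divff ?rX_neq0 // /spec_poly rmorph1 tofrac1.
Qed.

Lemma specXn f g k : spec f g -> spec (f ^+ k) (g ^+ k).
Proof.
move=> fg; elim: k => [|k IHk]; first by rewrite !expr0; apply: spec1.
by rewrite !exprS; apply: specM.
Qed.

Lemma spec_prod (J : Type) (s : seq J) (P : pred J) f g :
  (forall i, P i -> spec (f i) (g i)) ->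
  spec (\prod_(i <- s | P i) f i) (\prod_(i <- s | P i) g i).
Proof. by move=> fg; apply: big_ind2 => //; [apply: spec1|move=> *; apply: specM]. Qed.

Lemma spec_qpoch f g f' g' k :
  spec f g -> spec f' g' -> spec (qpoch f f' k) (qpoch g g' k).
Proof.
move=> fg fg'; apply: spec_prod => i _; apply: specD; first exact: spec1.
by apply: specN; apply: specM => //; apply: specXn.
Qed.

Lemma spec_hsym (T : eqType) (s : seq T) f g k :
  {in s, forall x, spec (f x) (g x)} -> spec (hsym (map f s) k) (hsym (map g s) k).
Proof.
elim: s k => [|x s IHs] [|k] fg; rewrite ?hsym0 ?hsym_nil; try exact: spec1.
  exact: spec0.
have fg' k' : spec (hsym (map f s) k') (hsym (map g s) k').
  by apply: IHs => y ys; apply: fg; rewrite inE ys orbT.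
elim: k => [|k IHk]; rewrite /= [X in spec X]hsym_cons [X in spec _ X]hsym_cons.
  apply: specD => //; apply: specM; first by apply: fg; rewrite mem_head.
  by rewrite !hsym0; apply: spec1.
by apply: specD => //; apply: specM => //; apply: fg; rewrite mem_head.
Qed.

End Specialization.

(** * The constant term *)

HB.instance Definition _ (F : fieldType) (n : nat) :=
  GRing.RMorphism.copy (@rC F n) (@FracField.tofrac _ \o @mpolyC n F).

Section ConstantTerm.
Variables (F : fieldType) (n : nat).
Implicit Types f g : ratf F n.

Lemma CT0 : CT (0 : ratf F n) = 0.
Proof. by rewrite (@CTE _ _ _ 0%MM 0) ?mcoeff0 // mulr0 tofrac0. Qed.

Lemma CTD f g : is_laurent f -> is_laurent g -> CT (f + g) = CT f + CT g.
Proof.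
move=> [d [p fE]] [e [p' gE]]; rewrite (CTE fE) (CTE gE).
rewrite (@CTE _ _ _ (d + e)%MM (p * 'X_[e] + p' * 'X_[d])).
  by rewrite mcoeffD mcoeffMX addmC mcoeffMX.
rewrite mpolyXD tofracD !tofracM mulrDr -fE -gE.
by move: ('X_[d]%:F) ('X_[e]%:F) => x y; ring.
Qed.

Lemma CTZ c f : is_laurent f -> CT (rC n c * f) = c * CT f.
Proof.
move=> [d [p fE]]; rewrite (CTE fE) (@CTE _ _ _ d (c%:MP * p)) ?mcoeffCM //.
by rewrite tofracM -fE mulrCA.
Qed.

Lemma is_laurent_sum (J : eqType) (s : seq J) (P : pred J) (f : J -> ratf F n) :
  (forall i, i \in s -> P i -> is_laurent (f i)) ->
  is_laurent (\sum_(i <- s | P i) f i).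
Proof.
move=> fL; rewrite big_seq_cond; elim/big_ind: _ => [||i /andP[]].
- by rewrite -tofrac0; apply: is_laurent_poly.
- exact: is_laurentD.
exact: fL.
Qed.

Lemma CT_sum (J : eqType) (s : seq J) (P : pred J) (f : J -> ratf F n) :
  (forall i, i \in s -> P i -> is_laurent (f i)) ->
  CT (\sum_(i <- s | P i) f i) = \sum_(i <- s | P i) CT (f i).
Proof.
elim: s => [|x s IHs] fL; first by rewrite !big_nil CT0.
have fL' i : i \in s -> P i -> is_laurent (f i).
  by move=> si; apply: fL; rewrite inE si orbT.
rewrite !big_cons; case: ifP => Px; last exact: IHs.
rewrite CTD ?IHs //; first by apply: fL => //; rewrite mem_head.
exact: is_laurent_sum.
Qed.

End ConstantTerm.

Lemma prod_pairsD1 (R : comPzRingType) n (S : {set 'I_n}) (P : 'I_n -> 'I_n -> R) i :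
  i \in S ->
  \prod_(k in S) \prod_(l in S | (k < l)%N) P k l =
  \prod_(k in S :\ i) \prod_(l in S :\ i | (k < l)%N) P k l *
  \prod_(k in S :\ i) (if (i < k)%N then P i k else P k i).
Proof.
move=> iS; rewrite (big_setD1 i) //= mulrC.
have -> : \prod_(l in S | (i < l)%N) P i l = \prod_(l in S :\ i | (i < l)%N) P i l.
  by apply: eq_bigl => l; rewrite !inE; case: eqP => // ->; rewrite ltnn andbF.
rewrite [X in _ * X]big_mkcondr /= -!big_split /=.
apply: eq_bigr => k; rewrite !inE => /andP[ki kS].
rewrite (bigID (pred1 i)) /= mulrAC [RHS]mulrC; congr (_ * _).
  case: ltngtP => [ik|ki'|/val_inj e]; last by rewrite e eqxx in ki.
    rewrite big_pred0 ?mul1r // => l; case: (eqVneq l i) => [->|]; last by rewrite andbF.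
    by rewrite ltnNge ltnW // andbF.
  rewrite mulr1 (big_pred1 i) // => l /=.
  by case: eqP => [->|]; rewrite ?iS ?ki' // andbF.
by apply: eq_bigl => l; rewrite !inE; case: (l == i); rewrite ?andbF ?andbT.
Qed.

(** * Expansion of the kernel *)

(** [P] stands for the denominators that the other variables bring to a letter: inverted in the
    expansion of h_r, a factor in the pair products. *)
Lemma mulf_cancel_regroup (K : fieldType) (P A B x y z D1 D2 D3 : K) : P != 0 ->
  x * D2 * (y * z * (B / P) * D3) * (D1 * (P * A)) =
  z * B * (y * x * D3 * A * (D2 * D1)).
Proof. by move=> P0; field. Qed.

Section Kernel.
Variables (F : fieldType) (q : F).
Hypotheses (hq0 : q != 0) (hq : forall k : nat, (0 < k)%N -> q ^+ k != 1).
Variables (n : nat) (a v : n.-tuple nat).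
Implicit Type S : {set 'I_n}.

Local Notation Q := (rC n q).
Local Notation X := (rX F).

Definition positions S : seq ('I_n * nat) :=
  [seq (i, j) | i <- enum S, j <- iota 0 (tnth a i)].

Definition letter (p : 'I_n * nat) : ratf F n := X p.1 * Q ^+ p.2.

Definition pair_factor (i j : 'I_n) : ratf F n :=
  qpoch (X i / X j) Q (tnth a i) * qpoch (Q * X j / X i) Q (tnth a j).

(* The kernel of D on the variables x_i with i in S, inside n variables. *)
Definition sub_kernel S : ratf F n :=
  (\prod_(i in S) X i ^- tnth v i) *
  (\prod_(i in S) hsym (map letter (positions S)) (tnth v i)) *
  \prod_(i in S) \prod_(j in S | (i < j)%N) pair_factor i j.

Lemma expq_inj : injective (fun k => q ^+ k).
Proof.
have le k l : (k <= l)%N -> q ^+ k = q ^+ l -> k = l.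
  move=> kl /eqP; rewrite -(subnK kl) exprD -subr_eq0 -{1}[q ^+ k]mul1r -mulrBl.
  rewrite mulf_eq0 expf_eq0 (negPf hq0) andbF orbF subr_eq0.
  case: (l - k)%N => [|d]; first by rewrite add0n.
  by rewrite eq_sym (negPf (hq (ltn0Sn d))).
by move=> k l; case: (leqP k l) => [/le//|/ltnW/le h /esym/h].
Qed.

Lemma rC_eq0 (c : F) : (rC n c == 0) = (c == 0).
Proof. exact: fmorph_eq0. Qed.

Lemma letter_inj : injective letter.
Proof.
move=> [i j] [k l]; rewrite /letter /= -!rmorphXn /rC /rX -!tofracM.
move=> /eqP; rewrite tofrac_eq ![_ * _%:MP]mulrC => /eqP e.
have := congr1 (mcoeff U_(i)%MM) e.
rewrite /= !mcoeffCM !mcoeffXU eqxx mulr1.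
case: eqP => [->|_]; first by rewrite mulr1 => /expq_inj ->.
by rewrite mulr0 => /eqP; rewrite expf_eq0 (negPf hq0) andbF.
Qed.

Lemma letter_neq0 p : letter p != 0.
Proof. by rewrite mulf_neq0 ?expf_neq0 ?rC_eq0 // rX_neq0. Qed.

Lemma positions_uniq S : uniq (positions S).
Proof.
apply: allpairs_uniq_dep; [exact: enum_uniq|by move=> *; apply: iota_uniq|].
by move=> [i j] [k l] /= _ _ [-> ->].
Qed.

Lemma big_positions (R : Type) (idx : R) (op : Monoid.com_law idx) S
    (P : pred ('I_n * nat)) G :
  \big[op/idx]_(p <- positions S | P p) G p =
  \big[op/idx]_(i in S) \big[op/idx]_(0 <= j < tnth a i | P (i, j)) G (i, j).
Proof.
rewrite big_mkcond big_allpairs_dep /= big_enum /=; apply: eq_bigr => i _.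
by rewrite [RHS]big_mkcond /index_iota subn0.
Qed.

(** The other letters of x_i contribute a constant to the denominator; those of x_k contribute the
    q-shifted factorial that the pair factor of i and k contains. *)
Lemma hsym_letters S r : (0 < r)%N ->
  hsym (map letter (positions S)) r =
  \sum_(i in S) \sum_(0 <= j < tnth a i)
    letter (i, j) ^+ r /
    ((\prod_(0 <= l < tnth a i | l != j) (1 - Q ^+ l / Q ^+ j)) *
     \prod_(k in S :\ i) qpoch (X k / (X i * Q ^+ j)) Q (tnth a k)).
Proof.
move=> r0; rewrite hsym_partial_fractions //; first last.
- by apply/mapP => -[p _ /esym/eqP]; rewrite (negPf (letter_neq0 p)).
- by rewrite map_inj_uniq ?positions_uniq //; apply: letter_inj.
rewrite big_map (big_positions _ _ predT) /=; apply: eq_bigr => i iS.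
apply: eq_bigr => j _; congr (_ / _).
rewrite big_map (eq_bigl (fun p => p != (i, j))); last first.
  by move=> p; rewrite (inj_eq letter_inj).
rewrite big_positions (big_setD1 i) //=; congr (_ * _).
  apply: eq_big => [l|l _]; first by rewrite xpair_eqE eqxx.
  by congr (1 - _); rewrite /letter /= -mulf_div divff ?mul1r // rX_neq0.
apply: eq_bigr => k; rewrite !inE => /andP[ki _].
rewrite /qpoch big_mkord; apply: eq_big => [l|l _].
  by rewrite xpair_eqE (negPf ki).
by congr (1 - _); rewrite /letter /= mulrAC.
Qed.

(** The cofactor in [qpoch_pair_lt] or [qpoch_pair_gt], a polynomial in x_i when k differs from
    i. *)
Definition residual (i k : 'I_n) (j : nat) : ratf F n :=
  let J := (j + (i < k))%N in
  let t := (if (i < k)%N then X i / X k else Q * X i / X k) in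
  \prod_(0 <= l < J) (Q ^+ tnth a k - Q ^+ l * t) *
  \prod_(J <= l < tnth a i) (1 - Q ^+ l * t).

Lemma pair_factor_residual (i k : 'I_n) j : (j < tnth a i)%N ->
  (if (i < k)%N then pair_factor i k else pair_factor k i) =
  qpoch (X k / (X i * Q ^+ j)) Q (tnth a k) * residual i k j.
Proof.
have Q0 : Q != 0 by rewrite rC_eq0.
move=> ja; rewrite /residual /pair_factor; case: ifP => _.
  by rewrite addn1 (qpoch_pair_lt _ Q0 _ _ ja) ?rX_neq0.
by rewrite addn0 (qpoch_pair_gt _ Q0 _ _ ja) ?rX_neq0.
Qed.

Lemma qpoch_letter_neq0 (i k : 'I_n) j : i != k -> qpoch (X k / (X i * Q ^+ j)) Q (tnth a k) != 0.
Proof.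
move=> ik; rewrite prodf_seq_neq0; apply/allP => l _ /=; rewrite subr_eq0 mulrAC.
apply: contra ik => /eqP e; suff /letter_inj[->] : letter (i, j) = letter (k, nat_of_ord l) by [].
by rewrite -[RHS](divfK (letter_neq0 (i, j))) -e mul1r.
Qed.

Definition spec_away (i k : 'I_n) : option 'I_n := if k == i then None else Some k.

Lemma spec_away_inj i k l m :
  spec_away i k = Some m -> spec_away i l = Some m -> k = l.
Proof. by rewrite /spec_away; do 2!case: ifP => // _; move=> [->] [->]. Qed.

(** At t = 0 each factor below the cut becomes q^(a_k) and each factor above it becomes 1. *)
Lemma spec_residual (i k : 'I_n) j : k != i -> (j < tnth a i)%N ->
  spec (spec_away i) (residual i k j) (rC n (q ^+ (tnth a k * (j + (i < k))))).
Proof.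
move=> ki ja; pose t := if (i < k)%N then X i / X k else Q * X i / X k.
have spC c : spec (spec_away i) (rC n c) (rC n c) by exact: spec_const.
have st : spec (spec_away i) t 0.
  have sk : spec (spec_away i) (X k)^-1 (X k)^-1.
    by apply: spec_varV; rewrite /spec_away (negPf ki).
  have si : spec (spec_away i) (X i) 0 by apply: spec_var0; rewrite /spec_away eqxx.
  rewrite /t; case: ifP => _; first by rewrite -[0](mul0r (X k)^-1); apply: specM.
  by rewrite -[0](mul0r (X k)^-1); apply: specM => //; rewrite -[0](mulr0 Q); apply: specM.
rewrite /residual -/t; set J := (j + _)%N.
have -> : rC n (q ^+ (tnth a k * J)) =
    \prod_(0 <= l < J) (Q ^+ tnth a k - Q ^+ l * 0) *
    \prod_(J <= l < tnth a i) (1 - Q ^+ l * 0).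
  rewrite [X in _ * X]big1 => [|l _]; last by rewrite mulr0 subr0.
  under eq_bigr do rewrite mulr0 subr0.
  by rewrite mulr1 prodr_const_nat subn0 -exprM rmorphXn.
have sq l : spec (spec_away i) (Q ^+ l * t) (Q ^+ l * 0).
  by apply: specM => //; apply: specXn.
apply: specM; apply: spec_prod => l _; apply: specD; try exact: specN.
  by apply: specXn.
exact: spec1.
Qed.

Lemma spec_hsym_letters i S k :
  spec (spec_away i) (hsym (map letter (positions S)) k)
    (hsym (map letter (positions (S :\ i))) k).
Proof.
pose g (p : 'I_n * nat) := if p.1 == i then 0 else letter p.
have -> : hsym (map letter (positions (S :\ i))) k = hsym (map g (positions S)) k.
  rewrite [RHS](@hsym_map_filter _ _ (fun p => p.1 != i)); last first.
    by move=> p /= /negPn/eqP pi; rewrite /g pi eqxx.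
  have -> : positions (S :\ i) = filter (fun p => p.1 != i) (positions S).
    rewrite /positions; have -> : enum (S :\ i) = filter (predC1 i) (enum S).
      by rewrite /enum_mem -filter_predI; apply: eq_filter => l; rewrite /= !inE.
    elim: (enum S) => //= l s IHs; rewrite filter_cat -IHs filter_map /preim /=.
    by case: ifP => _; rewrite ?filter_predT ?filter_pred0.
  congr (hsym _ _); apply/eq_in_map => p; rewrite mem_filter /g => /andP[].
  by case: (p.1 == i).
apply: spec_hsym => p _; rewrite /g /letter.
have sQ : spec (spec_away i) (Q ^+ p.2) (Q ^+ p.2) by apply: specXn; apply: spec_const.
case: eqP => [pi|/eqP pi].
  rewrite -(mul0r (Q ^+ p.2)); apply: specM => //.
  by apply: spec_var0; rewrite /spec_away pi eqxx.
by apply: specM => //; apply: spec_var; rewrite /spec_away (negPf pi).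
Qed.

Lemma spec_sub_kernel_away i S :
  spec (spec_away i)
    ((\prod_(k in S :\ i) X k ^- tnth v k) *
     \prod_(k in S :\ i) \prod_(l in S :\ i | (k < l)%N) pair_factor k l)
    ((\prod_(k in S :\ i) X k ^- tnth v k) *
     \prod_(k in S :\ i) \prod_(l in S :\ i | (k < l)%N) pair_factor k l).
Proof.
have spX k : k \in S :\ i -> spec (spec_away i) (X k) (X k).
  by rewrite !inE => /andP[ki _]; apply: spec_var; rewrite /spec_away (negPf ki).
have spV k : k \in S :\ i -> spec (spec_away i) (X k)^-1 (X k)^-1.
  by rewrite !inE => /andP[ki _]; apply: spec_varV; rewrite /spec_away (negPf ki).
have spQ : spec (spec_away i) Q Q by apply: spec_const.
apply: specM; apply: spec_prod => k kS.
  by rewrite -exprVn; apply: specXn; apply: spV.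
apply: spec_prod => l /andP[lS _]; apply: specM; apply: spec_qpoch => //.
  by apply: specM; [apply: spX|apply: spV].
by apply: specM; [apply: specM => //; apply: spX|apply: spV].
Qed.

Lemma sub_kernel_laurent S : is_laurent (sub_kernel S).
Proof.
have XL (i : 'I_n) : is_laurent (X i) by exact: (is_laurent_poly 'X_i).
have qL : is_laurent Q by exact: (is_laurent_poly q%:MP).
apply: is_laurentM; first apply: is_laurentM.
- apply: is_laurent_prod => i _; rewrite -exprVn.
  by apply: is_laurentXn; apply: is_laurentVX.
- apply: is_laurent_prod => i _; apply: is_laurent_hsym => f /mapP[p _ ->].
  by apply: is_laurentM => //; apply: is_laurentXn.
apply: is_laurent_prod => i _; apply: is_laurent_prod => j _.
apply: is_laurentM; apply: is_laurent_qpoch => //.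
  by apply: is_laurentM => //; apply: is_laurentVX.
by apply: is_laurentM; [apply: is_laurentM | apply: is_laurentVX].
Qed.

(** The expanded factor h_r is that of [i0]. In the term of a letter of x_i the powers of x_i
    combine to x_i^(r - v_i); as r bounds v on [S], this is a polynomial, so x_i = 0 is allowed and
    kills the term when v_i < r. *)
Lemma CT_sub_kernel_rec S i0 r :
  i0 \in S -> tnth v i0 = r -> (0 < r)%N -> {in S, forall k, (tnth v k <= r)%N} ->
  CT (sub_kernel S) =
  \sum_(i in S | tnth v i == r)
    q ^+ (\sum_(k in S | (i < k)%N) tnth a k) *
    hsym [seq q ^+ j | j <- iota 0 (tnth a i)] (r + asum a (S :\ i)) *
    CT (sub_kernel (S :\ i)).
Proof.
move=> i0S vi0 r0 vr.
pose c i j := q ^+ (j * r) / \prod_(0 <= l < tnth a i | l != j) (1 - q ^+ l / q ^+ j).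
pose rest i := (\prod_(k in S :\ i) X k ^- tnth v k) *
     \prod_(k in S :\ i) \prod_(l in S :\ i | (k < l)%N) pair_factor k l.
(* [rest i] is free of x_i, and the remaining factors contain no negative power of x_i. *)
pose term i j := rC n (c i j) * (X i ^+ (r - tnth v i) *
  \prod_(k in S :\ i0) hsym (map letter (positions S)) (tnth v k) *
  (\prod_(k in S :\ i) residual i k j) * rest i).
have KE : sub_kernel S = \sum_(i in S) \sum_(0 <= j < tnth a i) term i j.
  rewrite /sub_kernel [X in _ * X * _](big_setD1 i0) //= vi0 hsym_letters //.
  rewrite mulr_suml mulr_sumr mulr_suml; apply: eq_bigr => i iS.
  rewrite mulr_suml mulr_sumr mulr_suml; apply: eq_big_nat => j /andP[_ ja].
  rewrite (big_setD1 i) //= (@prod_pairsD1 _ _ _ pair_factor i) //.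
  have -> : \prod_(k in S :\ i) (if (i < k)%N then pair_factor i k else pair_factor k i) =
      \prod_(k in S :\ i) qpoch (X k / (X i * Q ^+ j)) Q (tnth a k) *
      \prod_(k in S :\ i) residual i k j.
    by rewrite -big_split; apply: eq_bigr => k _; apply: pair_factor_residual.
  have P0 : \prod_(k in S :\ i) qpoch (X k / (X i * Q ^+ j)) Q (tnth a k) != 0.
    rewrite prodf_seq_neq0; apply/allP => k _; apply/implyP.
    by rewrite !inE eq_sym => /andP[ki _]; apply: qpoch_letter_neq0.
  have cE : rC n (c i j) = Q ^+ (j * r) *
      (\prod_(0 <= l < tnth a i | l != j) (1 - Q ^+ l / Q ^+ j))^-1.
    rewrite /c rmorphM rmorphXn /= fmorphV rmorph_prod /=; congr (_ / _).
    by apply: eq_bigr => l _; rewrite rmorphB rmorphM fmorphV !rmorphXn rmorph1.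
  have xE : X i ^+ (r - tnth v i) = X i ^+ r * X i ^- tnth v i.
    by rewrite expfB_cond // (negPf (rX_neq0 F i)) vr.
  rewrite /term cE xE /rest /letter /= exprMn -exprM invfM.
  move: P0; move: (\prod_(k in S :\ i) qpoch _ _ _) => P.
  move: (\prod_(k in S :\ i) residual _ _ _) => A.
  move: (\prod_(0 <= l < _ | _) _)^-1 (X i ^- _) (X i ^+ r) (Q ^+ (j * r)) => B x y z.
  move: (\prod_(k in S :\ i) X k ^- _) (\prod_(k in S :\ i0) _).
  move: (\prod_(k in S :\ i) \prod_(l in _ | _) _) => D1 D2 D3 P0.
  exact: mulf_cancel_regroup.
have spec_term i j : i \in S -> (j < tnth a i)%N ->
    spec (spec_away i) (term i j) (rC n (c i j *
      \prod_(k in S :\ i) q ^+ (tnth a k * (j + (i < k)))) *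
      ((tnth v i == r)%:R * sub_kernel (S :\ i))).
  move=> iS ja.
  have -> : (tnth v i == r)%:R * sub_kernel (S :\ i) =
      0 ^+ (r - tnth v i) *
      (\prod_(k in S :\ i0) hsym (map letter (positions (S :\ i))) (tnth v k)) * rest i.
    rewrite expr0n subn_eq0; case: (eqVneq (tnth v i) r) => [vi|ne]; last first.
      by rewrite leqNgt ltn_neqAle ne vr // !mul0r.
    rewrite vi leqnn !mul1r /sub_kernel /rest -mulrA mulrCA; congr (_ * _).
    (* The expansion used up the factor of [i0], while [S :\ i] lacks that of [i]; both are h_r, so
       the products agree. *)
    case: (eqVneq i i0) => [->//|ii0].
    have i0S' : i0 \in S :\ i by rewrite !inE eq_sym ii0.
    have iS' : i \in S :\ i0 by rewrite !inE ii0.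
    rewrite (big_setD1 i0 i0S') [RHS](big_setD1 i iS') /=.
    by rewrite vi vi0 !setDDl setUC.
  rewrite rmorphM -[X in spec _ _ X]mulrA.
  have AE : forall A B C D : ratf F n, A * (B * C * D) = B * C * A * D.
    by move=> A B C D; rewrite mulrA [A * _]mulrC.
  rewrite AE.
  apply: specM; first exact: spec_const.
  apply: specM; last exact: spec_sub_kernel_away.
  apply: specM; last first.
    rewrite rmorph_prod; apply: spec_prod => k; rewrite !inE => /andP[ki _].
    exact: spec_residual.
  apply: specM; last by apply: spec_prod => k _; apply: spec_hsym_letters.
  by apply: specXn; apply: spec_var0; rewrite /spec_away eqxx.
(* Additivity of [CT] asks for Laurent terms; a term that has a specialization is Laurent. *)
rewrite KE CT_sum => [|i _ iS]; last first.
  apply: is_laurent_sum => j; rewrite mem_index_iota => /andP[_ ja] _.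
  exact: spec_laurent (spec_term i j iS ja).
rewrite [RHS]big_mkcondr /=; apply: eq_bigr => i iS.
rewrite CT_sum => [|j]; last first.
  rewrite mem_index_iota => /andP[_ ja] _.
  exact: spec_laurent (spec_term i j iS ja).
rewrite (eq_big_nat _ _ (fun j ja =>
  spec_CT (@spec_away_inj i) (spec_term i j iS (proj2 (andP ja))))).
case: eqP => vi; last by rewrite big1 // => j _; rewrite mul0r mulr0 CT0.
under eq_bigr do rewrite mul1r (CTZ _ (sub_kernel_laurent _)).
rewrite -mulr_suml; congr (_ * _).
(* The sum over j is again a partial fraction expansion, now over the letters q^j: the exponent j r
   + sum of a_k (j + [i < k]) is j (r + a_(S :\ i)) plus a part independent of j. *)
rewrite hsym_partial_fractions ?addn_gt0 ?r0 //; first last.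
- apply/mapP => -[j _ /esym/eqP]; rewrite expf_eq0 (negPf hq0) andbF //.
- by rewrite map_inj_uniq ?iota_uniq //; apply: expq_inj.
rewrite big_map mulr_sumr /index_iota subn0; apply: eq_bigr => j _.
rewrite big_map (eq_bigl (fun l => l != j)); last by move=> l; rewrite (inj_eq expq_inj).
rewrite prodrXr /c mulrAC [RHS]mulrA /index_iota subn0; congr (_ / _).
rewrite -exprM -!exprD; congr (q ^+ _).
rewrite [X in _ = (X + _)%N]big_mkcondr [X in _ = (X + _)%N](big_setD1 i iS) /=.
rewrite ltnn add0n.
rewrite mulnDr addnCA /asum; congr (_ + _)%N.
rewrite big_distrr -big_split; apply: eq_bigr => k _ /=.
by case: (i < k)%N; rewrite ?addn1 ?addn0 ?mulnS mulnC.
Qed.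

End Kernel.

(** * The alternating sum *)

Lemma sum_sets_with (V : nmodType) (T : finType) (x : T) (P : pred {set T})
    (f : {set T} -> V) :
  \sum_(K | P K && (x \in K)) f K = \sum_(J | P (x |: J) && (x \notin J)) f (x |: J).
Proof.
rewrite (reindex_onto (fun J => x |: J) (fun K => K :\ x)) /=; last first.
  by move=> K /andP[_ xK]; rewrite setD1K.
apply: eq_bigl => J; rewrite setU11 andbT; congr (_ && _).
apply/eqP/idP => [<-|xJ]; first by rewrite !inE eqxx.
by rewrite setU1K.
Qed.

(** The hypothesis says that 1 / dJ = ((1 - x) / dJ + x) / di. *)
Lemma mulf_partial_split (K : fieldType) (w b t x dJ di : K) :
  dJ != 0 -> di != 0 -> dJ * x = x - 1 + di ->
  w * (b * t) / dJ = w * b * (t / di) * ((1 - x) / dJ) + t / di * (w * b * x).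
Proof.
move=> dJ0 di0 e; have -> : 1 - x = di - dJ * x by rewrite e; ring.
by field; rewrite dJ0 di0.
Qed.

Section Combinatorics.
Variables (F : fieldType) (q : F).
Hypotheses (hq0 : q != 0) (hq : forall k : nat, (0 < k)%N -> q ^+ k != 1).
Variables (n : nat) (a : n.-tuple nat) (r : nat).
Hypothesis r0 : (0 < r)%N.
Implicit Types S I J K : {set 'I_n}.

Definition above K (i : 'I_n) : nat := \sum_(k in K | (i < k)%N) tnth a k.

Definition sub_Lexp S I J : nat :=
  \sum_(i in I) \sum_(j in S | (i <= j)%N && (j \notin J)) tnth a j.

Definition alt_sum S I : F :=
  \sum_(J : {set 'I_n} | J \subset I)
    (-1) ^+ #|I :\: J| * q ^+ sub_Lexp S I J *
    ((1 - q ^+ asum a J) / (1 - q ^+ (asum a (S :\: J) + r))).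

Lemma subr_expq_neq0 k : (0 < k)%N -> 1 - q ^+ k != 0.
Proof. by move=> k0; rewrite subr_eq0 eq_sym hq. Qed.

Lemma asum0 : asum a set0 = 0%N.
Proof. exact: big_set0. Qed.

Lemma asumU1 i J : i \notin J -> asum a (i |: J) = (tnth a i + asum a J)%N.
Proof. by move=> iJ; rewrite /asum big_setU1. Qed.

Lemma asumD1 i S : i \in S -> asum a S = (tnth a i + asum a (S :\ i))%N.
Proof. by move=> iS; rewrite /asum (big_setD1 i). Qed.

Lemma aboveU1 i j J : j \notin J ->
  above (j |: J) i = ((i < j) * tnth a j + above J i)%N.
Proof.
move=> jJ; rewrite /above big_mkcondr big_setU1 //= -big_mkcondr /=.
by case: (i < j)%N; rewrite ?mul1n.
Qed.

(** Each summand is the difference of consecutive values of [f], the power of q given by the tail of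
    [K] from t on. *)
Lemma sum_above K : \sum_(i in K) q ^+ above K i * (1 - q ^+ tnth a i) = 1 - q ^+ asum a K.
Proof.
pose f t := q ^+ (\sum_(k in K | (t <= k)%N) tnth a k).
have -> : 1 - q ^+ asum a K = f n - f 0%N.
  rewrite /f big_pred0 => [|k]; last by rewrite leqNgt ltn_ord andbF.
  by rewrite expr0; congr (_ - q ^+ _); apply: eq_bigl => k; rewrite andbT.
rewrite -(telescope_sumr f (leq0n n)) big_mkord big_mkcond /=.
apply: eq_bigr => i _; rewrite mulrBr mulr1 -exprD /f.
have -> : (\sum_(k in K | (i <= k)%N) tnth a k = above K i + (i \in K) * tnth a i)%N.
  rewrite (bigID (pred1 i)) /= addnC; congr (_ + _)%N.
    by apply: eq_bigl => k; rewrite -andbA ltn_neqAle [(_ <= _)%N && _]andbC eq_sym.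
  case iK: (i \in K); rewrite ?mul1n.
    by rewrite (big_pred1 i) // => k /=; case: eqP => [->|]; rewrite ?iK ?leqnn ?andbF.
  by rewrite big_pred0 // => k /=; case: eqP => [->|]; rewrite ?iK ?andbF.
by case: (i \in K); rewrite ?mul1n ?mul0n ?addn0 ?subrr.
Qed.

(** Leaving i out of J adds a_i once for each k in I with k <= i, so the multiplicity is the rank of
    i in I. *)
Lemma sub_LexpU1 S I J i : I \subset S -> i \in I -> i \notin J ->
  sub_Lexp S I J =
  (sub_Lexp S I (i |: J) + (\sum_(k in I) (k <= i)) * tnth a i)%N.
Proof.
move=> IS iI iJ; rewrite big_distrl -big_split /=; apply: eq_bigr => k kI.
have iS := subsetP IS i iI.
rewrite (bigID (pred1 i)) /= addnC; congr (_ + _)%N.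
  by apply: eq_bigl => l; rewrite !inE negb_or -!andbA; do !bool_congr; rewrite andbC.
case ki: (k <= i)%N; last first.
  by rewrite big_pred0 // => l; case: eqP => [->|]; rewrite ?ki ?andbF.
rewrite mul1n (big_pred1 i) // => l /=.
by case: eqP => [->|]; rewrite ?iS ?ki ?iJ ?andbF.
Qed.

(** Row i of [sub_Lexp S I (i |: J)] counts the indices above i outside J; adding those inside J
    completes [above S i]. *)
Lemma sub_Lexp_rem S I J i : I \subset S -> i \in I -> J \subset I ->
  (above S i + sub_Lexp (S :\ i) (I :\ i) J =
   sub_Lexp S I (i |: J) + above (i |: J) i)%N.
Proof.
move=> IS iI JI; rewrite /sub_Lexp [in RHS](big_setD1 i) //= addnAC.
congr (_ + _)%N; last first.
  apply: eq_bigr => k _; apply: eq_bigl => l; rewrite !inE negb_or.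
  by case: (l == i); case: (l \in S); case: (k <= l)%N.
rewrite /above (bigID [pred l | l \in i |: J]) /= addnC; congr (_ + _)%N.
  apply: eq_bigl => l; rewrite !inE negb_or -!andbA ltn_neqAle.
  by rewrite eq_sym; case: eqP => [/val_inj->|_] /=; rewrite ?eqxx ?andbF.
apply: eq_bigl => l; rewrite -andbA andbC -andbA andbC; congr (_ && _).
apply: andb_idr; rewrite !inE => /orP[/eqP->|lJ]; first exact: (subsetP IS).
exact: (subsetP (subset_trans JI IS)).
Qed.

(** Let j be least in [I :\ i]; its rank in I is 1 + [i < j]. Taking j out of J raises [sub_Lexp] by
    (1 + [i < j]) a_j and lowers the other two exponents by [i < j] a_j and a_j, so only the sign
    changes. A singleton I has no such j, hence the separate base case [alt_sum1]. *)
Lemma alt_sum_cancel S I i : I \subset S -> i \in I -> (1 < #|I|)%N ->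
  \sum_(J : {set 'I_n} | (J \subset I) && (i \in J))
    (-1) ^+ #|I :\: J| * q ^+ (sub_Lexp S I J + above J i + asum a (J :\ i)) = 0 :> F.
Proof.
move=> IS iI I1.
have [j0 j0I] : exists j, j \in I :\ i.
  by apply/set0Pn; rewrite -card_gt0; move: I1; rewrite (cardsD1 i I) iI.
case: (@arg_minnP _ j0 [pred j | j \in I :\ i] (@nat_of_ord n) j0I) => j /=.
rewrite !inE => /andP[ji jI] jmin.
have rank : (\sum_(k in I) (k <= j) = 1 + (i < j))%N.
  rewrite (big_setD1 j) //= leqnn (big_setD1 i) ?inE 1?eq_sym ?ji //=.
  rewrite big1 ?addn0 => [|k]; first by rewrite leq_eqVlt val_eqE eq_sym (negPf ji).
  rewrite !inE => /and3P[ki kj kI]; apply/eqP; rewrite eqb0 -ltnNge.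
  by rewrite ltn_neqAle eq_sym val_eqE kj jmin // !inE ki.
rewrite (bigID [pred J : {set 'I_n} | j \in J]) /= sum_sets_with.
rewrite [X in X + _](eq_bigl (fun J => (J \subset I) && (i \in J) && (j \notin J))); last first.
  by move=> J; rewrite subUset sub1set jI !inE eq_sym (negPf ji).
rewrite -big_split big1 //= => J /andP[/andP[JI iJ] jJ].
rewrite (sub_LexpU1 IS jI jJ) rank aboveU1 //.
have -> : (j |: J) :\ i = j |: (J :\ i).
  by apply/setP => k; rewrite !inE; case: eqP => [->|//]; rewrite eq_sym (negPf ji).
rewrite asumU1 ?inE ?(negPf jJ) ?andbF //.
have -> : #|I :\: J| = #|I :\: (j |: J)|.+1.
  by rewrite (cardsD1 j) !inE jI jJ setDDl setUC.
rewrite exprS mulN1r mulNr; apply/eqP; rewrite subr_eq0; apply/eqP.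
by congr (_ * q ^+ _); ring.
Qed.

Lemma alt_sum_rec S I : I \subset S -> (1 < #|I|)%N ->
  alt_sum S I = \sum_(i in I) q ^+ above S i *
    ((1 - q ^+ tnth a i) / (1 - q ^+ (asum a (S :\ i) + r))) *
    alt_sum (S :\ i) (I :\ i).
Proof.
move=> IS I1.
pose d (J : {set 'I_n}) := 1 - q ^+ (asum a (S :\: J) + r).
pose w (J : {set 'I_n}) : F := (-1) ^+ #|I :\: J| * q ^+ sub_Lexp S I J.
have d0 J : d J != 0 by rewrite subr_expq_neq0 // addn_gt0 r0 orbT.
have inner i : i \in I -> q ^+ above S i *
    ((1 - q ^+ tnth a i) / (1 - q ^+ (asum a (S :\ i) + r))) *
    alt_sum (S :\ i) (I :\ i) =
    \sum_(J : {set 'I_n} | (J \subset I) && (i \in J))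
      w J * (q ^+ above J i * (1 - q ^+ tnth a i)) / d J.
  move=> iI; pose g := (1 - q ^+ tnth a i) / d [set i].
  (* The partial fraction split produces the i-th term of the recursion and a remainder, which
     [alt_sum_cancel] annihilates. *)
  have -> : \sum_(J : {set 'I_n} | (J \subset I) && (i \in J))
      w J * (q ^+ above J i * (1 - q ^+ tnth a i)) / d J =
      \sum_(J : {set 'I_n} | (J \subset I) && (i \in J))
      (w J * q ^+ above J i * g * ((1 - q ^+ asum a (J :\ i)) / d J) +
       g * ((-1) ^+ #|I :\: J| *
         q ^+ (sub_Lexp S I J + above J i + asum a (J :\ i)))).
    apply: eq_bigr => J /andP[JI iJ].
    have e : d J * q ^+ asum a (J :\ i) = q ^+ asum a (J :\ i) - 1 + d [set i].
      rewrite /d mulrBl mul1r -exprD addrA subrK; congr (_ - q ^+ _).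
      rewrite addnAC; congr (_ + _)%N.
      rewrite addnC /asum [RHS](big_setID J) /=; congr (_ + _)%N; apply: eq_bigl => k.
        rewrite !inE; case kJ: (k \in J); rewrite ?andbF //.
        by rewrite (subsetP IS _ (subsetP JI _ kJ)) !andbT.
      by rewrite !inE; case: eqP => [->|]; rewrite ?iJ.
    rewrite (mulf_partial_split _ _ _ (d0 J) (d0 [set i]) e) !exprD.
    by congr (_ + _ * _); rewrite !mulrA.
  rewrite big_split -big_distrr /= alt_sum_cancel // mulr0 addr0 sum_sets_with.
  rewrite mulr_sumr; apply: eq_big => J.
    by rewrite subsetD1 subUset sub1set iI.
  rewrite subsetD1 => /andP[JI iJ].
  rewrite /w /g /d setU1K // -!setDDl -[in RHS]mulrA mulrACA.
  have := congr1 (fun k => q ^+ k) (sub_Lexp_rem IS iI JI); rewrite !exprD => e.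
  rewrite -[_ * _ * q ^+ above _ _ in RHS]mulrA -e.
  by congr (_ * _); apply: mulrCA.
(* After exchanging the sums, the weight and denominator of J are independent of i, leaving the sum
   of [sum_above]. *)
rewrite (eq_bigr _ inner) (exchange_big_dep [pred J : {set 'I_n} | J \subset I]) /=.
  apply: eq_bigr => J JI; rewrite -mulr_suml -mulr_sumr -[RHS]mulrA -sum_above.
  congr (_ * (_ / _)); apply: eq_bigl => i.
  by rewrite JI andb_idl //; apply: (subsetP JI).
by move=> i J _ /andP[].
Qed.

End Combinatorics.

(** * Restriction to a subset of the variables *)

(** The kernel depends on the order of the indices, so the renaming must preserve it. *)
Lemma enum_val_ltn n (A : {set 'I_n}) (i j : 'I_#|A|) :
  (enum_val i < enum_val j)%N = (i < j)%N.
Proof.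
have mono (k l : 'I_#|A|) : (k < l)%N -> (enum_val k < enum_val l)%N.
  move=> kl; have x0 := enum_val k; rewrite !(enum_val_nth x0).
  have s : sorted ltn (map val (enum A)).
    rewrite /enum_mem sorted_map; apply: sorted_filter; first by move=> x y z; apply: ltn_trans.
    by rewrite -sorted_map -enumT val_enum_ord iota_ltn_sorted.
  rewrite sorted_map in s.
  by apply: (sorted_ltn_nth _ x0 s) => //; [move=> x y z; apply: ltn_trans|rewrite inE -cardE..].
case: (ltngtP i j) => [/mono//|/mono ji|/val_inj->]; last by rewrite ltnn.
by rewrite ltnNge ltnW.
Qed.

Lemma map_enum_val n (A : {set 'I_n}) : map enum_val (enum 'I_#|A|) = enum A.
Proof.
have sz : size (map enum_val (enum 'I_#|A|)) = size (enum A).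
  by rewrite size_map size_enum_ord cardE.
case: (pickP 'I_#|A|) => [i0 _|no]; last first.
  by case: (enum 'I_#|A|) sz => [|j s] /=; [move=> /esym/size0nil ->|have := no j].
apply: (@eq_from_nth _ (enum_val i0) _ _ sz) => k; rewrite size_map size_enum_ord => kA.
by rewrite (nth_map i0) ?size_enum_ord // (enum_val_nth (enum_val i0)) nth_enum_ord.
Qed.

Section Renaming.
Variables (F : fieldType) (q : F).

(** A product of complete functions ignores sorting, so each part can be attached to its own
    variable. *)
Lemma kernelD_sub_kernel n (v a : n.-tuple nat) :
  kernelD q v (sort_decr v) a = sub_kernel q a v setT.
Proof.
have inT (R : Type) (idx : R) (op : Monoid.com_law idx) (P : pred 'I_n) G :
    \big[op/idx]_(i in [set: 'I_n] | P i) G i = \big[op/idx]_(i < n | P i) G i.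
  by apply: eq_bigl => i; rewrite inE.
have inT1 (R : Type) (idx : R) (op : Monoid.com_law idx) G :
    \big[op/idx]_(i in [set: 'I_n]) G i = \big[op/idx]_(i < n) G i.
  by apply: eq_bigl => i; rewrite inE.
rewrite /kernelD /sub_kernel !inT1; congr (_ * _ * _).
  have -> : alphabet q a = map (@letter F q n) (positions a [set: 'I_n]).
    rewrite /alphabet /positions map_allpairs /letter /=.
    by have -> : enum [set: 'I_n] = enum 'I_n by apply: eq_enum => i; rewrite inE.
  rewrite /hsymp /sort_decr; set s := map _ _.
  rewrite (perm_big v) ?perm_sort //= -[X in \prod_(k <- X) _ = _]map_tnth_enum.
  by rewrite big_map big_enum.
by apply: eq_bigr => i _; rewrite inT.
Qed.

Variables (n : nat) (v a : n.-tuple nat) (I : {set 'I_n}).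

Lemma tnth_rem_entries (s : n.-tuple nat) i :
  tnth (rem_entries I s) i = tnth s (enum_val i).
Proof. by rewrite (tnth_nth 0%N) nth_image. Qed.

Lemma spec_sub_kernel_enum_val :
  spec (fun i : 'I_#|~: I| => Some (enum_val i))
    (sub_kernel q (rem_entries I a) (rem_entries I v) setT) (sub_kernel q a v (~: I)).
Proof.
set u := fun _ => _.
have spX (i : 'I_#|~: I|) : spec u (rX F i) (rX F (enum_val i)) by exact: spec_var.
have spV (i : 'I_#|~: I|) : spec u (rX F i)^-1 (rX F (enum_val i))^-1 by exact: spec_varV.
have spQ : spec u (rC _ q) (rC _ q) by exact: spec_const.
rewrite /sub_kernel; apply: specM; first apply: specM.
- rewrite [X in spec _ _ X]big_enum_val.
  rewrite (eq_bigl predT) => [|i]; last by rewrite inE.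
  by apply: spec_prod => i _; rewrite tnth_rem_entries -!exprVn; apply: specXn.
- rewrite [X in spec _ _ X]big_enum_val.
  rewrite (eq_bigl predT) => [|i]; last by rewrite inE.
  apply: spec_prod => i _; rewrite tnth_rem_entries.
  have -> : positions a (~: I) =
      [seq (enum_val p.1, p.2) | p <- positions (rem_entries I a) [set: 'I_#|~: I|]].
    rewrite /positions map_allpairs -map_enum_val.
    have -> : enum [set: 'I_#|~: I|] = enum 'I_#|~: I| by apply: eq_enum => k; rewrite inE.
    elim: (enum 'I_#|~: I|) => //= k s ->.
    by rewrite tnth_rem_entries.
  rewrite -map_comp; apply: spec_hsym => p _.
  by apply: specM => //; apply: specXn.
rewrite [X in spec _ _ X]big_enum_val.
rewrite (eq_bigl predT) => [|i]; last by rewrite inE.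
apply: spec_prod => i _.
rewrite [X in spec _ _ X]big_enum_val_cond.
rewrite (eq_bigl (fun j : 'I_#|~: I| => (enum_val i < enum_val j)%N)) => [|j];
  last by rewrite inE enum_val_ltn.
apply: spec_prod => j _; rewrite /pair_factor !tnth_rem_entries.
by apply: specM; apply: spec_qpoch => //; apply: specM => //; apply: specM.
Qed.

Lemma D_rem_entries :
  D q (rem_entries I v) (sort_decr (rem_entries I v)) (rem_entries I a) =
    CT (sub_kernel q a v (~: I)).
Proof.
rewrite /D kernelD_sub_kernel; apply: (spec_CT _ spec_sub_kernel_enum_val).
by move=> i j k [<-] [/enum_val_inj].
Qed.

End Renaming.

(** * The recursion *)

Section Recursion.
Variables (F : fieldType) (q : F).
Hypotheses (hq0 : q != 0) (hq : forall k : nat, (0 < k)%N -> q ^+ k != 1).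
Variables (n : nat) (a v : n.-tuple nat) (s : nat).
Hypothesis ha : forall i : 'I_n, (0 < tnth a i)%N.
Implicit Types S I J : {set 'I_n}.

(** The quotient of q-multinomials for s = r - 1, with the factors of s and of the indices outside I
    cancelled. *)
Definition ratio S I : F :=
  qpoch q q (asum a S + s) /
  ((\prod_(i in I) qpoch q q (tnth a i)) * qpoch q q (asum a (S :\: I) + s)).

Lemma qpoch_neq0 k : qpoch q q k != 0.
Proof.
rewrite prodf_seq_neq0; apply/allP => i _ /=.
by rewrite -exprS (subr_expq_neq0 hq).
Qed.

Lemma hsym_ratio S i : i \in S ->
  hsym [seq q ^+ j | j <- iota 0 (tnth a i)] (s.+1 + asum a (S :\ i)) =
  ratio S [set i] * ((1 - q ^+ tnth a i) / (1 - q ^+ (asum a (S :\ i) + s.+1))).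
Proof.
move=> iS; rewrite /ratio big_set1 (asumD1 a iS) addnS.
(* Positivity of a_i gives a_i = b + 1, the number of letters in [hsym_geom]. *)
have := ha i; case: (tnth a i) => // b _; have := hsym_geom q b (s.+1 + asum a (S :\ i)).
set A := asum a (S :\ i); have -> : (s.+1 + A + b = b.+1 + A + s)%N by ring.
rewrite [(s.+1 + A)%N]addSn [(s + A)%N]addnC => <-; rewrite !qpochS -!exprS.
have := qpoch_neq0 (A + s); have := qpoch_neq0 b.
have := subr_expq_neq0 hq (ltn0Sn (A + s)); have := subr_expq_neq0 hq (ltn0Sn b).
move: (1 - _) (1 - _) (qpoch _ _ _) (qpoch _ _ _) (hsym _ _) => x y z t h x0 y0 z0 t0.
by field; rewrite x0 y0 z0 t0.
Qed.

Lemma ratio_rec S I i : I \subset S -> i \in I ->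
  ratio S [set i] * ratio (S :\ i) (I :\ i) = ratio S I.
Proof.
move=> IS iI; rewrite /ratio big_set1 [in RHS](big_setD1 i iI) /= setDDl.
have -> : i |: I :\ i = I by rewrite setD1K.
have P0 : \prod_(k in I :\ i) qpoch q q (tnth a k) != 0.
  by rewrite prodf_seq_neq0; apply/allP => k _; rewrite qpoch_neq0 implybT.
have := qpoch_neq0 (asum a (S :\: I) + s); have := qpoch_neq0 (asum a (S :\ i) + s).
have := qpoch_neq0 (tnth a i); move: P0.
move: (\prod_(k in _) _) (qpoch _ _ (asum a S + s)) (qpoch _ _ (tnth a i)).
move: (qpoch _ _ _) (qpoch _ _ _) => x y z t w z0 w0 x0 y0.
by field; rewrite z0 w0 x0 y0.
Qed.

Lemma alt_sum1 S i : i \in S ->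
  alt_sum q a s.+1 S [set i] =
  q ^+ above a S i * ((1 - q ^+ tnth a i) / (1 - q ^+ (asum a (S :\ i) + s.+1))).
Proof.
move=> iS; rewrite /alt_sum (bigD1 [set i]) //= (big_pred1 set0) => [|J]; last first.
  rewrite subset1; case: (eqVneq J [set i]) => [->|] /=; last by rewrite andbT.
  by apply/esym/negbTE/set0Pn; exists i; rewrite set11.
rewrite asum0 expr0 subrr mul0r mulr0 addr0 setDv cards0 mul1r.
rewrite {1}/asum big_set1; congr (q ^+ _ * _); rewrite /sub_Lexp big_set1.
apply: eq_bigl => k; rewrite !inE ltn_neqAle -val_eqE eq_sym.
by rewrite [_ && (_ != _)]andbC.
Qed.

(** Induction on the size of I: for i in I, [I :\ i] is again the set of indices of [S :\ i] with
    part r, and removing both leaves [S :\: I] unchanged. *)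
Lemma CT_sub_kernel_remove_max S I :
  I = [set i in S | tnth v i == s.+1] -> I != set0 ->
  {in S, forall k, (tnth v k <= s.+1)%N} ->
  CT (sub_kernel q a v S) =
  CT (sub_kernel q a v (S :\: I)) * (ratio S I * alt_sum q a s.+1 S I).
Proof.
have [m] := ubnP #|I|; elim: m => // m IHm in S I *; rewrite ltnS => Im IE I0 vS.
have IS : I \subset S by apply/subsetP => k; rewrite IE inE => /andP[].
have [i0 i0I] := set0Pn _ I0.
have [i0S /eqP vi0] : i0 \in S /\ tnth v i0 == s.+1.
  by move: i0I; rewrite IE inE => /andP[].
rewrite (CT_sub_kernel_rec hq0 hq a i0S vi0) //.
rewrite (eq_bigl (fun i => i \in I)) => [|i]; last by rewrite IE inE.
have HE i : i \in I -> q ^+ (\sum_(k in S | (i < k)%N) tnth a k) *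
    hsym [seq q ^+ j | j <- iota 0 (tnth a i)] (s.+1 + asum a (S :\ i)) =
    ratio S [set i] * (q ^+ above a S i *
      ((1 - q ^+ tnth a i) / (1 - q ^+ (asum a (S :\ i) + s.+1)))).
  by move=> iI; rewrite hsym_ratio ?(subsetP IS) // mulrCA.
case: (ltnP 1 #|I|) => I1.
  rewrite (alt_sum_rec hq a (ltn0Sn s) IS I1) !mulr_sumr; apply: eq_bigr => i iI.
  rewrite HE // (IHm (S :\ i) (I :\ i)) //.
  - rewrite setDDl setD1K // -(ratio_rec IS iI).
    by move: (ratio _ _) (ratio _ _) (_ * (_ / _)) => x y z; ring.
  - by apply: leq_trans Im; rewrite [X in (_ < X)%N](cardsD1 i I) iI.
  - by apply/setP => k; rewrite IE !inE andbA.
  - by rewrite -card_gt0; move: I1; rewrite (cardsD1 i I) iI.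
  - by move=> k; rewrite !inE => /andP[_]; apply: vS.
have {I1} I1 : #|I| == 1%N by rewrite eqn_leq I1 card_gt0.
have [i Ii] := cards1P I1; have iI : i \in I by rewrite Ii set11.
by rewrite Ii big_set1 HE // alt_sum1 ?(subsetP IS) // mulrC.
Qed.

End Recursion.

Theorem theorem1p1 (F : fieldType) (q : F) (hq0 : q != 0)
    (hq : forall k : nat, (0 < k)%N -> q ^+ k != 1)
    (n : nat) (a : n.-tuple nat) (ha : forall i : 'I_n, (0 < tnth a i)%N)
    (v : n.-tuple nat) (hv : exists i : 'I_n, tnth v i <> 0%N)
    (r : nat) (hr : r = (\max_(i < n) tnth v i)%N)
    (I : {set 'I_n}) (hI : I = [set i : 'I_n | tnth v i == r]) :
  D q v (sort_decr v) a =
    D q (rem_entries I v) (sort_decr (rem_entries I v)) (rem_entries I a) *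
    (qmultinom q (sumn a + r - 1) (rcons a (r - 1)%N) /
     qmultinom q (sumn a - asum a I + r - 1)
       (rcons (rem_entries I a) (r - 1)%N)) *
    \sum_(J : {set 'I_n} | (J != set0) && (J \subset I))
      (-1) ^+ #|I :\: J| * q ^+ Lexp I J a *
      ((1 - q ^+ asum a J) / (1 - q ^+ (sumn a - asum a J + r))).
Proof.
have vr (k : 'I_n) : (tnth v k <= r)%N by rewrite hr (leq_bigmax k).
have [i0 vi0] := hv.
have r0 : (0 < r)%N by rewrite (leq_trans _ (vr i0)) // lt0n; apply/eqP.
have I0 : I != set0.
  have [|i1 vi1] := @eq_bigmax _ (fun i : 'I_n => tnth v i).
    by rewrite card_ord (leq_trans _ (ltn_ord i0)).
  by apply/set0Pn; exists i1; rewrite hI inE hr vi1.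
case: r => [//|s] in hr hI vr r0 *; rewrite !addnS !subn1 /= in hr *.
have aT : sumn a = asum a setT.
  by rewrite sumnE big_tuple /asum; apply: eq_bigl => i; rewrite inE.
(* The truncated subtraction is exact, being a sum over the complement. *)
have aD (J : {set 'I_n}) : (sumn a - asum a J = asum a (setT :\: J))%N.
  by rewrite aT {1}/asum (big_setID J) /= setTI addKn.
rewrite {1}/D kernelD_sub_kernel (CT_sub_kernel_remove_max hq0 hq (s := s) ha (I := I)) //; first last.
  by rewrite hI; apply/setP => i; rewrite !inE.
rewrite D_rem_entries setTD -mulrA; congr (_ * (_ * _)).
  rewrite aD aT /ratio /qmultinom setTD.
  have -> : \prod_(k <- rcons [seq tnth a i | i in ~: I] s) qpoch q q k =
      (\prod_(i in ~: I) qpoch q q (tnth a i)) * qpoch q q s.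
    by rewrite -cats1 big_cat big_seq1 big_image.
  have -> : \prod_(k <- rcons a s) qpoch q q k =
      (\prod_(i in I) qpoch q q (tnth a i)) *
      (\prod_(i in ~: I) qpoch q q (tnth a i)) * qpoch q q s.
    rewrite -cats1 big_cat big_seq1 big_tuple (bigID [pred i | i \in I]) /=; congr (_ * _ * _).
    by apply: eq_bigl => i; rewrite inE.
  have P0 (A : {set 'I_n}) : \prod_(i in A) qpoch q q (tnth a i) != 0.
    by rewrite prodf_seq_neq0; apply/allP => k _; rewrite qpoch_neq0 ?implybT.
  have := qpoch_neq0 hq (asum a (~: I) + s); have := qpoch_neq0 hq s.
  have := P0 (~: I); have := P0 I.
  move: (\prod_(i in I) _) (\prod_(i in ~: I) _) (qpoch q q s) (qpoch q q (asum a (~: I) + s)).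
  by move=> x y z t x0 y0 z0 t0; field; rewrite x0 y0 z0 t0.
rewrite /alt_sum (bigD1 set0) ?sub0set //= asum0 expr0 subrr mul0r mulr0 add0r.
apply: eq_big => [J|J _]; first by rewrite andbC.
rewrite aD addnS; congr (_ * q ^+ _ * _); apply: eq_bigr => i _.
by apply: eq_bigl => j; rewrite inE.
Qed.
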